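(* Let $f,g\in\mathbb{Z}[X]$ be nonconstant relatively prime polynomials, let $\theta_{1},\dots,\theta_{n}$ and $\xi_{1},\dots,\xi_{m}$ be the complex roots (listed with multiplicity) of $f$ and $g$, respectively, where $n=\deg f$ and $m=\deg g$, and assume that $\theta_{1}\cdots\theta_{n}\xi_{1}\cdots\xi_{m}\neq 0$. If for some integer $k>0$ we have $$\min_{i,j}|\theta_{i}-\xi_{j}|>d_k^{1/\min(m,n)}\quad\text{or}\quad \min_{i,j}\left|\frac{1}{\theta_{i}}-\frac{1}{\xi_{j}}\right|>d_k^{1/\min(m,n)},$$ then each one of $f$ and $g$ is a product of at most $k$ irreducible factors over $\mathbb{Q}$ (counting multiplicities).
   Context: $Res(f,g)$ is the resultant of $f$ and $g$. For a positive integer $k$, $$d_k:=\max\left\{d\in\mathbb{Z}_{>0}:\ d\mid |Res(f,g)|\ \text{and}\ d\leq\sqrt[k+1]{|Res(f,g)|}\right\}.$$ *)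

(* Defs.v *)
From HB Require Import structures.
From mathcomp Require Import all_boot all_order all_algebra.
From mathcomp Require Import complex.
From mathcomp Require Import reals exp.

Set Implicit Arguments.
Unset Strict Implicit.
Unset Printing Implicit Defensive.

Import Order.TTheory GRing.Theory Num.Theory.
Import Normc.
Local Open Scope ring_scope.

Notation int_to_rat_poly := (map_poly (intr : int -> rat)).

(* Listing with multiplicity: the nonzero polynomial p splits as its leading
   coefficient times the product of the X - z, z in s. *)
Definition lists_roots (R : realType) (p : {poly int}) (s : seq R[i]) : Prop :=
  map_poly intr p = (lead_coef p)%:~R *: \prod_(z <- s) ('X - z%:P).

(* The default value head 0 s is itself an entry of s as soon as s is
   nonempty, so this is then the true minimum of s. *)
Definition seq_min (R : realType) (s : seq R) : R :=
  \big[Num.min/head 0 s]_(x <- s) x.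

Definition min_dist (R : realType) (s t : seq R[i]) : R :=
  seq_min [seq normc (x - y) | x <- s, y <- t].

(* `^ is the real power powR; d = 1 is always admissible when the resultant is
   nonzero, so the maximum is over a nonempty set of positive integers. *)
Definition dk (R : realType) (f g : {poly int}) (k : nat) : nat :=
  let N := `|resultant f g|%N in
  \max_(d <- divisors N | d%:R <= (N%:R : R) `^ (k.+1)%:R^-1) d.

Definition product_of_at_most_irreducibles
    (F : fieldType) (k : nat) (p : {poly F}) : Prop :=
  exists s : seq {poly F},
    [/\ (size s <= k)%N,
        forall q, q \in s -> irreducible_poly q
      & p = \prod_(q <- s) q].

(* Main.v *)
Require Import Defs.
From HB Require Import structures.
From mathcomp Require Import all_boot all_order all_algebra all_field.
From mathcomp Require Import complex.
From mathcomp Require Import boolp reals exp.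

Set Implicit Arguments.
Unset Strict Implicit.
Unset Printing Implicit Defensive.

Import Order.TTheory GRing.Theory Num.Theory.
Local Open Scope ring_scope.

(** The resultant is multiplicative, and over the complex numbers it is, up to
    sign, [a ^ m * b ^ n] times the product of all differences [x - y] of a root
    [x] of [f] and a root [y] of [g], where [a], [b] are the leading
    coefficients and [n], [m] the degrees ([resultant_prod_roots],
    [normr_resultant]). If all these differences have modulus at least [e], then
    every nonconstant integer factor [p] of [f] satisfies
    [e ^ (deg p * m) <= |Res(p, g)|], because leading coefficients are nonzero
    integers ([resultant_ge_root_separation]). The same bound follows from the
    separation of the inverses of the roots, with constant coefficients in place
    of leading ones ([resultant_ge_inv_root_separation]). When
    [e > dk ^ (1 / min(m, n))] and [dk >= 1], it gives [|Res(p, g)| > dk].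

    By Gauss's lemma, [f] is a product of integer polynomials that are
    irreducible over the rationals ([int_poly_irreducible_factors]). Their
    resultants with [g] are divisors of [N = |Res(f, g)|] with product [N]. All
    of them exceed [dk], hence exceed the [(k+1)]-st root of [N] by the
    maximality of [dk], so there cannot be [k+1] or more of them
    ([size_factors_leq]). The statement for [g] follows because [dk] and the
    separation are symmetric in [f] and [g].

    The product formula itself comes from multiplying the Sylvester matrix by a
    Vandermonde matrix: the result holds the values of the polynomials at the
    nodes, and it is block triangular when the nodes include the roots of one of
    them. This requires distinct roots; the general case is obtained by moving
    the roots apart with an indeterminate and then specializing it to 0. *)

(** * The resultant as a product over roots *)

Lemma det_Vandermonde_row_mx (R : comPzRingType) (m n : nat)
    (y : 'rV[R]_m) (x : 'rV[R]_n) :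
  \det (Vandermonde (m + n) (row_mx y x)) =
  \det (Vandermonde m y) * \det (Vandermonde n x)
  * \prod_i \prod_j (x 0 j - y 0 i).
Proof.
rewrite !det_Vandermonde big_split_ord /= mulrAC -big_split /=.
congr (_ * _); apply: eq_bigr => i _; rewrite big_split_ord /=.
  congr (_ * _).
    by apply: eq_bigr => j _; rewrite !row_mxEl.
  apply: eq_big => [j|j _]; last by rewrite row_mxEl row_mxEr.
  exact: ltn_addr.
rewrite big_pred0 ?mul1r => [|j]; last first.
  by apply/negbTE; rewrite -leqNgt ltnW // ltn_addr.
by apply: eq_big => [j|j _]; rewrite ?ltn_add2l ?row_mxEr.
Qed.

(** Row [i] of a Sylvester band is the coefficient vector of ['X^i * r], and
    multiplying a coefficient vector by a Vandermonde matrix evaluates the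
    polynomial at the nodes. *)
Lemma mul_lin1_mx_Vandermonde (R : comNzRingType) (r : {poly R}) (d e n l : nat)
    (c : 'rV[R]_l) :
  (size r <= d.+1)%N -> (e + d <= n)%N ->
  lin1_mx (@poly_rV R n \o r \o* (@rVpoly R e)) *m Vandermonde n c =
  Vandermonde e c *m diag_mx (\row_j r.[c 0 j]).
Proof.
move=> szr len; apply/matrixP=> i j; rewrite mul_mx_diag !mxE.
have sz : (size ('X^i * r)%R <= n)%N.
  apply: leq_trans (size_polyMleq _ _) _; rewrite size_polyXn addSn /=.
  apply: leq_trans (leq_add (leqnn i) szr) (leq_trans _ len).
  by rewrite addnS -addSn leq_add2r.
rewrite [in RHS]mulrC -[X in _ * X]hornerXn -hornerM mulrC.
rewrite (horner_coef_wide _ sz); apply: eq_bigr => k _.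
by rewrite !mxE /= rVpoly_delta mulrC.
Qed.

(** The product of the Sylvester matrix with the Vandermonde matrix of the
    nodes [y], [x] consists of the values of [p] and [q] at these nodes; it is
    block triangular because [p] vanishes at every [x]. *)
Lemma resultant_Vandermonde (R : comNzRingType) (p q : {poly R})
    (y : 'rV[R]_(size q).-1) (x : 'rV[R]_(size p).-1) :
  (forall j, root p (x 0 j)) ->
  resultant p q * \det (Vandermonde _ (row_mx y x)) =
  \det (Vandermonde _ y) * \det (Vandermonde _ x)
  * (\prod_i p.[y 0 i] * \prod_j q.[x 0 j]).
Proof.
move=> px0; rewrite /resultant -det_mulmx /Sylvester_mx mul_col_mx.
rewrite (mul_lin1_mx_Vandermonde (d := (size p).-1)) ?leqSpred //.
rewrite (mul_lin1_mx_Vandermonde (d := (size q).-1)) ?leqSpred 1?addnC //.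
have split_diag k (r : {poly R}) (V := Vandermonde k) :
    V _ (row_mx y x) *m diag_mx (\row_j r.[row_mx y x 0 j]) =
    row_mx (V _ y *m diag_mx (\row_j r.[y 0 j]))
           (V _ x *m diag_mx (\row_j r.[x 0 j])).
  apply/matrixP=> i j; rewrite mul_mx_diag !mxE.
  by case: split => l; rewrite mul_mx_diag !mxE.
rewrite !split_diag.
have -> : Vandermonde (size q).-1 x *m diag_mx (\row_j p.[x 0 j]) = 0.
  by apply/matrixP=> i j; rewrite mul_mx_diag !mxE (rootP (px0 j)) mulr0.
rewrite -[col_mx _ _]/(block_mx _ _ _ _) det_lblock !det_mulmx !det_diag.
rewrite mulrACA; congr (_ * (_ * _)); apply: eq_bigr => i _; exact: mxE.
Qed.

(** Distinct nodes make the Vandermonde determinant regular, so it can be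
    cancelled. The auxiliary nodes [y] only complete the roots of [p] to a
    square Vandermonde matrix. *)
Lemma resultant_distinct_roots (D : idomainType) (p q : {poly D})
    (y : 'rV[D]_(size q).-1) (x : 'rV[D]_(size p).-1) :
    injective (row_mx y x 0) -> 
    p = lead_coef p *: \prod_j ('X - (x 0 j)%:P) ->
  resultant p q =
  ((-1) ^+ (size p).-1 * lead_coef p) ^+ (size q).-1 * \prod_j q.[x 0 j].
Proof.
move=> inj_yx def_p.
have V_neq0 : \det (Vandermonde _ (row_mx y x)) != 0.
  rewrite det_Vandermonde; apply/prodf_neq0 => i _; apply/prodf_neq0 => j ltij.
  by rewrite subr_eq0 (inj_eq inj_yx) -val_eqE gtn_eqF.
have pE c : p.[c] = lead_coef p * \prod_j (c - x 0 j).
  have := congr1 (horner^~ c) def_p; rewrite /= hornerZ horner_prod => ->.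
  by congr (_ * _); apply: eq_bigr => j _; rewrite hornerXsubC.
have powE (c : D) k : c ^+ k = \prod_(i < k) c by rewrite prodr_const card_ord.
have px0 j : root p (x 0 j).
  by rewrite /root pE (bigD1 j) //= subrr mul0r mulr0.
apply: (mulIf V_neq0); rewrite (resultant_Vandermonde _ px0).
rewrite det_Vandermonde_row_mx [RHS]mulrC -[RHS]mulrA; congr (_ * _).
rewrite mulrA; congr (_ * _).
rewrite [X in _ * X]powE -big_split /=.
apply: eq_bigr => i _; rewrite pE.
rewrite mulrC mulrA; congr (_ * _).
rewrite powE -big_split /=.
by apply: eq_bigr => j _; rewrite mulrN1 opprB.
Qed.

(** Repeated roots are handled by a perturbation: over [{poly F}] the elements
    [s`_k + k 'X] are pairwise distinct, so the previous lemma applies to them,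
    and evaluating at 0 gives back [p] and [q]. *)
Lemma resultant_prod_roots (F : numDomainType) (p q : {poly F}) (s : seq F) :
    p != 0 -> q != 0 -> p = lead_coef p *: \prod_(x <- s) ('X - x%:P) ->
  resultant p q =
  ((-1) ^+ size s * lead_coef p) ^+ (size q).-1 * \prod_(x <- s) q.[x].
Proof.
move=> p_neq0 q_neq0 def_p.
have [lp_neq0 lq_neq0]: lead_coef p != 0 /\ lead_coef q != 0.
  by rewrite !lead_coef_eq0.
have sz_p : (size p).-1 = size s by rewrite def_p size_scale // size_prod_XsubC.
pose z k : {poly F} := (s`_k)%:P + k%:R *: 'X.
have inj_z : injective z.
  move=> k l /(congr1 (coefp 1)) /eqP.
  rewrite /= /z !coefD !coefC !coefZ !coefX /= !add0r !mulr1 eqr_nat => /eqP //.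
pose P := (lead_coef p)%:P *: \prod_(0 <= k < size s) ('X - (z k)%:P).
pose Q := map_poly (@polyC F) q.
have lP : lead_coef P = (lead_coef p)%:P.
  by rewrite lead_coefZ (monicP (monic_prod_XsubC _ _ _)) mulr1.
have szP : (size P).-1 = size s.
  by rewrite size_scale ?polyC_eq0 // size_prod_XsubC size_iota subn0.
have lQ : lead_coef Q = (lead_coef q)%:P.
  by rewrite lead_coef_map_inj //; apply: polyC_inj.
have szQ : size Q = size q by rewrite size_map_inj_poly //; apply: polyC_inj.
(* Evaluation at 0 preserves the two leading coefficients, hence the shape of
   the Sylvester matrix. *)
pose ev := horner_eval (0 : F).
have evP : map_poly ev P = p.
  rewrite map_polyZ rmorph_prod [RHS]def_p big_mkord (big_nth 0) big_mkord /=.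
  congr (_ *: _); first by rewrite /ev horner_evalE hornerC.
  apply: eq_bigr => k _.
  by rewrite rmorphB /= map_polyX map_polyC /= horner_evalE /z !hornerE.
have evQ : map_poly ev Q = q.
  rewrite -map_poly_comp map_poly_id // => c _ /=.
  by rewrite /ev horner_evalE hornerC.
pose x := \row_(j < (size P).-1) z j.
(* Any fresh elements would do as auxiliary nodes; the next terms of [z] are
   distinct from the earlier ones. *)
pose y := \row_(i < (size Q).-1) z (size s + i)%N.
have inj_yx : injective (row_mx y x 0).
  have def_yx k : row_mx y x 0 k = z (match split k with
      inl i => size s + i | inr j => j end)%N.
    by rewrite mxE; case: split => l; rewrite mxE.
  move=> k l; rewrite !def_yx => /inj_z.
  have ltx (j : 'I_(size P).-1) : (j < size s)%N by rewrite -szP.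
  case: splitP => i k_i; case: splitP => j l_j eqij; apply: val_inj => /=.
  - by rewrite k_i l_j; apply: (@addnI (size s)).
  - by have := ltx j; rewrite -eqij ltnNge leq_addr.
  - by have := ltx i; rewrite eqij ltnNge leq_addr.
  - by rewrite k_i l_j eqij.
have def_P : P = lead_coef P *: \prod_j ('X - (x 0 j)%:P).
  rewrite lP {1}/P; congr (_ *: _); rewrite -{1}szP big_mkord.
  by apply: eq_bigr => j _; rewrite mxE.
rewrite -[in LHS]evP -[in LHS]evQ -map_resultant.
- rewrite (resultant_distinct_roots inj_yx def_P) rmorphM rmorph_prod.
  congr (_ * _).
    rewrite szP szQ lP rmorphXn rmorphM rmorphXn rmorphN1.
    by rewrite [X in _ * X]horner_evalE hornerC.
  rewrite [RHS](big_nth 0) big_mkord -[in RHS]szP; apply: eq_bigr => j _.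
  have ev_z : ev (z j) = s`_j by rewrite [ev _]horner_evalE /z !hornerE.
  by rewrite -evQ -ev_z mxE horner_map.
- by rewrite lP /= horner_evalE hornerC.
- by rewrite lQ /= horner_evalE hornerC.
Qed.

(** * Multiplicativity, symmetry and size of integer resultants *)

Lemma prodr_const_seq (R : pzSemiRingType) (I : Type) (s : seq I) (c : R) :
  \prod_(i <- s) c = c ^+ size s.
Proof. by elim: s => [|i s IHs]; rewrite ?big_nil // big_cons IHs exprS. Qed.

Lemma resultant_map_inj (R S : nzRingType) (h : {rmorphism R -> S})
    (p q : {poly R}) :
  injective h -> resultant (map_poly h p) (map_poly h q) = h (resultant p q).
Proof.
move=> inj_h; rewrite /resultant /Sylvester_mx !size_map_inj_poly ?rmorph0 //.
rewrite -det_map_mx map_col_mx; congr (\det (col_mx _ _)).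
  apply/matrixP=> i j; rewrite !mxE /= !rVpoly_delta.
  by rewrite -(map_polyXn h) -rmorphM coef_map.
apply/matrixP=> i j; rewrite !mxE /= !rVpoly_delta.
by rewrite -(map_polyXn h) -rmorphM coef_map.
Qed.

Lemma resultantM (C : numClosedFieldType) (p1 p2 q : {poly C}) :
  p1 != 0 -> p2 != 0 -> q != 0 ->
  resultant (p1 * p2) q = resultant p1 q * resultant p2 q.
Proof.
move=> p1_neq0 p2_neq0 q_neq0.
have [[s1 def1] [s2 def2]] :=
  (closed_field_poly_normal p1, closed_field_poly_normal p2).
have def12 : p1 * p2 = lead_coef (p1 * p2) *: \prod_(x <- s1 ++ s2) ('X - x%:P).
  by rewrite lead_coefM {1}def1 {1}def2 -scalerAl -scalerAr scalerA big_cat.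
rewrite (resultant_prod_roots _ q_neq0 def12) ?mulf_neq0 //.
rewrite (resultant_prod_roots _ q_neq0 def1) //.
rewrite (resultant_prod_roots _ q_neq0 def2) //.
by rewrite size_cat exprD lead_coefM mulrACA exprMn big_cat mulrACA.
Qed.

Lemma normr_resultant (F : numDomainType) (p q : {poly F}) (s t : seq F) :
    p != 0 -> q != 0 ->
    p = lead_coef p *: \prod_(x <- s) ('X - x%:P) ->
    q = lead_coef q *: \prod_(y <- t) ('X - y%:P) ->
  `|resultant p q| = `|lead_coef p| ^+ size t * `|lead_coef q| ^+ size s
                     * \prod_(x <- s) \prod_(y <- t) `|x - y|.
Proof.
move=> p_neq0 q_neq0 def_p def_q.
have sz_q : (size q).-1 = size t.
  by rewrite def_q size_scale ?lead_coef_eq0 // size_prod_XsubC.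
rewrite (resultant_prod_roots p_neq0 q_neq0 def_p) normrM normrX normrM sz_q.
rewrite normrX normrN1 expr1n mul1r -mulrA; congr (_ * _).
rewrite normr_prod -prodr_const_seq -big_split; apply: eq_bigr => x _ /=.
rewrite {1}def_q hornerZ normrM horner_prod normr_prod; congr (_ * _).
by apply: eq_bigr => y _; rewrite hornerXsubC.
Qed.

Lemma normr_resultantC (C : numClosedFieldType) (p q : {poly C}) :
  p != 0 -> q != 0 -> `|resultant p q| = `|resultant q p|.
Proof.
move=> p_neq0 q_neq0.
have [[s def_p] [t def_q]] :=
  (closed_field_poly_normal p, closed_field_poly_normal q).
rewrite (normr_resultant p_neq0 q_neq0 def_p def_q).
rewrite (normr_resultant q_neq0 p_neq0 def_q def_p) exchange_big mulrAC.
rewrite -mulrA mulrC -!mulrA mulrCA.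
by congr (_ * _); rewrite mulrC; congr (_ * _); apply: eq_bigr => y _;
  apply: eq_bigr => x _; rewrite distrC.
Qed.

Lemma map_poly_intr_eq0 (F : numDomainType) (p : {poly int}) :
  (map_poly (intr : int -> F) p == 0) = (p == 0).
Proof. by rewrite -!size_poly_eq0 size_map_inj_poly //; apply: intr_inj. Qed.

(** Integer identities are checked after embedding in the algebraic numbers,
    where the polynomials split. *)
Lemma absz_resultantC (p q : {poly int}) :
  p != 0 -> q != 0 -> `|resultant p q|%N = `|resultant q p|%N.
Proof.
move=> p_neq0 q_neq0; have injC := @intr_inj algC.
apply/eqP; rewrite -(eqr_nat algC) !natr_absz !intr_norm.
rewrite -!(resultant_map_inj _ _ injC).
by rewrite normr_resultantC // map_poly_intr_eq0.
Qed.

Lemma resultant_prod (l : seq {poly int}) (q : {poly int}) :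
    q != 0 -> (forall p, p \in l -> p != 0) ->
  resultant (\prod_(p <- l) p) q = \prod_(p <- l) resultant p q.
Proof.
move=> q_neq0; have injC := @intr_inj algC.
have nzC (p : {poly int}) : p != 0 -> map_poly (intr : int -> algC) p != 0.
  by rewrite map_poly_intr_eq0.
elim: l => [|p l IHl] nz_l; apply: (injC); rewrite -(resultant_map_inj _ _ injC).
  rewrite !big_nil rmorph1 (@resultant_prod_roots _ _ _ [::]) ?oner_eq0 ?nzC //.
    by rewrite big_nil lead_coef1 !mulr1 expr1n.
  by rewrite big_nil lead_coef1 scale1r.
have nz_l' r : r \in l -> r != 0 by move=> l_r; rewrite nz_l ?inE ?l_r ?orbT.
rewrite !big_cons !rmorphM resultantM ?(resultant_map_inj _ _ injC)
  -?IHl ?nzC //.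
  by rewrite nz_l ?mem_head.
by rewrite prodf_seq_neq0; apply/allP => r /nz_l'.
Qed.

Local Notation int_to C := (map_poly (intr : int -> C)).

Lemma intr_poly_normal (C : numClosedFieldType) (p : {poly int}) :
    p != 0 ->
  exists s : seq C, [/\ size s = (size p).-1,
    int_to C p = lead_coef (int_to C p) *: \prod_(x <- s) ('X - x%:P),
    lead_coef (int_to C p) = (lead_coef p)%:~R
    & forall x, x \in s -> root (int_to C p) x].
Proof.
move=> p_neq0; have [s def_p] := closed_field_poly_normal (int_to C p).
have inj_int := @intr_inj C.
have lead_p := lead_coef_map_inj inj_int (erefl 0) p.
have nz_p : lead_coef (int_to C p) != 0.
  by rewrite lead_coef_eq0 map_poly_intr_eq0.
exists s; split=> // [|x s_x].
  by rewrite -(size_map_inj_poly inj_int (erefl 0)) def_p size_scale //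
    size_prod_XsubC.
by rewrite def_p rootZ // root_prod_XsubC.
Qed.

Lemma normr_intr_ge1 (F : numDomainType) (z : int) : z != 0 -> 1 <= `|z%:~R : F|.
Proof. by move=> nz_z; rewrite -intr_norm ler1z -gtz0_ge1 normr_gt0. Qed.

Lemma expr_le_prod2 (F : numDomainType) (I : eqType) (d : F) (s t : seq I)
    (D : I -> I -> F) :
    0 <= d -> (forall x y, x \in s -> y \in t -> d <= D x y) ->
  d ^+ (size s * size t) <= \prod_(x <- s) \prod_(y <- t) D x y.
Proof.
move=> d_ge0 le_dD; rewrite mulnC exprM -prodr_const_seq big_seq_cond.
rewrite [leRHS]big_seq_cond; apply: ler_prod => x /andP[s_x _].
rewrite exprn_ge0 //= -prodr_const_seq big_seq_cond [leRHS]big_seq_cond.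
by apply: ler_prod => y /andP[t_y _]; rewrite d_ge0 le_dD.
Qed.

(** In the product formula the leading coefficients are nonzero integers, so
    their absolute values are at least 1, and each of the
    [deg p * deg q] remaining factors is at least [d]. *)
Lemma resultant_ge_root_separation (C : numClosedFieldType)
    (p q : {poly int}) (d : C) :
    p != 0 -> q != 0 -> 0 <= d ->
    (forall x y, root (int_to C p) x -> root (int_to C q) y -> d <= `|x - y|) ->
  d ^+ ((size p).-1 * (size q).-1) <= `|(resultant p q)%:~R|.
Proof.
move=> p_neq0 q_neq0 d_ge0 sep.
have [s [<- def_p lead_p root_s]] := intr_poly_normal C p_neq0.
have [t [<- def_q lead_q root_t]] := intr_poly_normal C q_neq0.
rewrite -resultant_map_inj; last exact: intr_inj.
rewrite (normr_resultant _ _ def_p def_q) ?map_poly_intr_eq0 //.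
apply: le_trans (expr_le_prod2 d_ge0 _) _.
  by move=> x y /root_s px /root_t qy; apply: sep px qy.
rewrite ler_peMl ?prodr_ge0 // => [x _|]; first by rewrite prodr_ge0.
by rewrite lead_p lead_q mulr_ege1 ?exprn_ege1 ?normr_intr_ge1 ?lead_coef_eq0.
Qed.

(** Writing [`|x - y|] as [`|x| * `|y| * `|x^-1 - y^-1|] in the product formula
    turns each leading coefficient into the absolute value of a constant
    coefficient, again a nonzero integer. *)
Lemma resultant_ge_inv_root_separation (C : numClosedFieldType)
    (p q : {poly int}) (d : C) :
    p != 0 -> q != 0 -> 0 <= d ->
    p`_0 != 0 -> q`_0 != 0 ->
    (forall x y, root (int_to C p) x -> root (int_to C q) y ->
       d <= `|x^-1 - y^-1|) ->
  d ^+ ((size p).-1 * (size q).-1) <= `|(resultant p q)%:~R|.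
Proof.
move=> p_neq0 q_neq0 d_ge0 p0 q0 sep.
have [s [<- def_p lead_p root_s]] := intr_poly_normal C p_neq0.
have [t [<- def_q lead_q root_t]] := intr_poly_normal C q_neq0.
have root_neq0 (r : {poly int}) x : r`_0 != 0 -> root (int_to C r) x -> x != 0.
  move=> r0; apply: contraTneq => ->.
  by rewrite rootE horner_coef0 coef_map intr_eq0.
(* Vieta's formula for the constant coefficient. *)
have coef0E (r : {poly int}) (l : seq C) :
    int_to C r = lead_coef (int_to C r) *: \prod_(x <- l) ('X - x%:P) ->
  `|lead_coef (int_to C r)| * \prod_(x <- l) `|x| = `|(r`_0)%:~R|.
  move=> def_r; have -> : (r`_0)%:~R = (int_to C r)`_0 by rewrite coef_map.
  rewrite [in RHS]def_r coefZ coef0_prod_XsubC.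
  by rewrite !normrM normrX normrN1 expr1n mul1r normr_prod.
rewrite -resultant_map_inj; last exact: intr_inj.
rewrite (normr_resultant _ _ def_p def_q) ?map_poly_intr_eq0 //.
have -> : \prod_(x <- s) \prod_(y <- t) `|x - y| =
    (\prod_(x <- s) `|x|) ^+ size t * (\prod_(y <- t) `|y|) ^+ size s
    * \prod_(x <- s) \prod_(y <- t) `|x^-1 - y^-1|.
  rewrite -prodrXl -[X in _ * X * _]prodr_const_seq -!big_split.
  apply: eq_big_seq => x s_x /=; rewrite -prodr_const_seq -!big_split /=.
  apply: eq_big_seq => y t_y; rewrite -!normrM distrC; congr (`|_|).
  have x_neq0 := root_neq0 _ _ p0 (root_s x s_x).
  have y_neq0 := root_neq0 _ _ q0 (root_t y t_y).
  by rewrite mulrBr mulrAC mulfV // mul1r mulfK.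
rewrite mulrA mulrACA -!exprMn !coef0E //.
apply: le_trans (expr_le_prod2 d_ge0 _) _.
  by move=> x y /root_s px /root_t qy; apply: sep px qy.
rewrite ler_peMl ?prodr_ge0 // => [x _|]; first by rewrite prodr_ge0.
by rewrite mulr_ege1 ?exprn_ege1 ?normr_intr_ge1.
Qed.

(** * Factorizations over the integers and their number of factors *)

(** By Gauss's lemma an integer polynomial that is reducible over the rationals
    is a product of two integer polynomials of smaller degree: the primitive
    part of a rational divisor divides it over the integers. The integer content
    is absorbed in the factors. *)
Lemma int_poly_irreducible_factors (p : {poly int}) : (1 < size p)%N ->
  exists l : seq {poly int},
    (forall q, q \in l -> irreducible_poly (int_to_rat_poly q)) /\
    p = \prod_(q <- l) q.
Proof.
have [n] := ubnP (size p); elim: n p => // n IHn p le_p_n p_gt1.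
have [irr_p | red_p] := pselect (irreducible_poly p).
  exists [:: p]; rewrite big_seq1; split=> // q /[!inE] /eqP->.
  exact/irreducible_rat_int.
have p_neq0 : p != 0 by rewrite -size_poly_gt0 ltnW.
have [q [q_neq1 q_p neq_qp]] : exists q : {poly int},
    [/\ size q != 1%N, q %| p & ~~ (q %= p)].
  apply: contrapT => no_q; apply: red_p; split=> // q q_neq1 q_p.
  by apply/negPn/negP => neq_qp; apply: no_q; exists q.
have [r def_p] := dvdpP_int q_p.
have q_gt1 : (1 < size (zprimitive q))%N.
  rewrite size_zprimitive ltn_neqAle eq_sym q_neq1 size_poly_gt0.
  by apply: contraNneq p_neq0 => q0; rewrite def_p q0 zprimitive0 mul0r.
(* A constant cofactor would make [q] associated with [p]. *)
have r_gt1 : (1 < size r)%N.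
  rewrite ltnNge; apply: contra neq_qp => /size1_polyC def_r.
  have def_p' : p = r`_0 *: zprimitive q.
    by rewrite [LHS]def_p {1}def_r mulrC mul_polyC.
  have c_neq0 : r`_0 != 0.
    by apply: contraNneq p_neq0 => c0; rewrite def_p' c0 scale0r.
  have zc_neq0 : zcontents q != 0.
    by rewrite zcontents_eq0 -zprimitive_eq0 -size_poly_gt0 ltnW.
  rewrite [in q %= _](zpolyEprim q) (eqp_trans (eqp_scale _ zc_neq0)) //.
  by rewrite eqp_sym def_p' eqp_scale.
have lt_pred_addn a b : (1 < b)%N -> (a < (a + b).-1)%N.
  by case: b => [|[|b]] // _; rewrite !addnS /= ltnS leq_addr.
have szp : size p = (size (zprimitive q) + size r).-1.
  by rewrite def_p size_mul // -size_poly_gt0 ltnW.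
have [|lq [irr_lq def_q]] := IHn (zprimitive q) _ q_gt1.
  by rewrite -ltnS (leq_trans _ le_p_n) // szp ltnS lt_pred_addn.
have [|lr [irr_lr def_r]] := IHn r _ r_gt1.
  by rewrite -ltnS (leq_trans _ le_p_n) // szp addnC ltnS lt_pred_addn.
exists (lq ++ lr); rewrite big_cat /= -def_q -def_r; split=> // s.
by rewrite mem_cat => /orP[/irr_lq|/irr_lr].
Qed.

Lemma leq_dk (R : realType) (f g : {poly int}) (k d : nat) :
    resultant f g != 0 -> (d %| `|resultant f g|)%N ->
    d%:R <= (`|resultant f g|%N%:R : R) `^ k.+1%:R^-1 ->
  (d <= dk R f g k)%N.
Proof.
move=> res_neq0 d_dvd d_le; rewrite /dk.
apply: (leq_bigmax_seq (F := fun d => d)) => //.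
by rewrite -dvdn_divisors // absz_gt0.
Qed.

(** Each [`|resultant p g|] divides [N = `|resultant f g|], so if it exceeds
    [dk] it must exceed [N `^ k.+1%:R^-1]. More than [k] such numbers would have
    a product larger than [N], but their product is [N] by multiplicativity. *)
Lemma size_factors_leq (R : realType) (f g : {poly int}) (k : nat)
    (l : seq {poly int}) :
    resultant f g != 0 -> f != 0 -> g != 0 -> f = \prod_(p <- l) p ->
    (forall p, p \in l -> (dk R f g k < `|resultant p g|)%N) ->
  (size l <= k)%N.
Proof.
move=> res_neq0 f_neq0 g_neq0 def_f gt_dk; rewrite leqNgt; apply/negP => k_lt.
set N := `|resultant f g|%N; pose c : R := N%:R `^ k.+1%:R^-1.
have N_gt0 : (0 < N)%N by rewrite absz_gt0.
have l_neq0 p : p \in l -> p != 0.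
  by move: f_neq0; rewrite def_f prodf_seq_neq0 => /allP nz /nz.
have def_N : N = (\prod_(p <- l) `|resultant p g|)%N.
  by rewrite /N {1}def_f resultant_prod // (big_morph absz abszM absz1).
have c_ge1 : 1 <= c.
  by rewrite -[leLHS](powRr0 N%:R) ler_powR ?ler1n ?invr_ge0 ?ler0n.
have lt_c p : p \in l -> c < `|resultant p g|%N%:R.
  move=> l_p; rewrite ltNge; apply/negP => le_c.
  have := gt_dk p l_p; rewrite ltnNge leq_dk //.
  by rewrite -/N def_N (big_rem p) //= dvdn_mulr.
have : N%:R = c ^+ k.+1.
  by rewrite -powR_mulrn ?powR_ge0 // -powRrM mulVf ?pnatr_eq0 // powRr1 ?ler0n.
move/eqP; rewrite gt_eqF //; apply: le_lt_trans (ler_weXn2l c_ge1 k_lt) _.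
rewrite def_N natr_prod -prodr_const_seq big_seq_cond [ltRHS]big_seq_cond.
apply: ltr_prod => [|p /andP[l_p _]]; last by rewrite powR_ge0 lt_c.
by case: (l) k_lt => //= p l' _; rewrite mem_head.
Qed.

(** * From separated roots to few irreducible factors *)

Lemma powR_inv_lt_expr (R : realType) (a e : R) (M j : nat) :
  1 <= a -> (0 < M <= j)%N -> a `^ M%:R^-1 < e -> a < e ^+ j.
Proof.
move=> a_ge1 /andP[M_gt0 le_Mj] lt_e.
have r_ge1 : 1 <= a `^ M%:R^-1.
  by rewrite -[leLHS](powRr0 a) ler_powR // invr_ge0 ler0n.
have -> : a = (a `^ M%:R^-1) ^+ M.
  rewrite -powR_mulrn ?powR_ge0 // -powRrM mulVf ?pnatr_eq0 -?lt0n //.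
  by rewrite powRr1 // (le_trans ler01).
apply: le_lt_trans (ler_weXn2l r_ge1 le_Mj) _.
by rewrite ltrXn2r ?powR_ge0 // gtn_eqF // (leq_trans M_gt0).
Qed.

Lemma dk_gt0 (R : realType) (f g : {poly int}) (k : nat) :
  resultant f g != 0 -> (0 < dk R f g k)%N.
Proof.
move=> res_neq0; apply: leq_dk => //.
by rewrite -[leLHS](powRr0 `|resultant f g|%N%:R) ler_powR
  ?ler1n ?absz_gt0 // invr_ge0 ler0n.
Qed.

(** The two alternatives are kept together because they pass in the same way
    to factors of [p] and to the exchanged pair. *)
Definition roots_separated (C : numClosedFieldType) (e : C) (p q : {poly int}) :=
  let root_of (r : {poly int}) (x : C) := root (map_poly intr r) x in
  (forall x y, root_of p x -> root_of q y -> e <= `|x - y|) \/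
  [/\ p`_0 != 0, q`_0 != 0
    & forall x y, root_of p x -> root_of q y -> e <= `|x^-1 - y^-1|].

Lemma roots_separatedC (C : numClosedFieldType) (e : C) (p q : {poly int}) :
  roots_separated e p q -> roots_separated e q p.
Proof.
case=> [sep|[p0 q0 sep]]; [left|right; split=> //] => x y qx py.
  by rewrite distrC sep.
by rewrite distrC sep.
Qed.

Lemma roots_separated_factor (C : numClosedFieldType) (e : C)
    (p r q : {poly int}) :
  roots_separated e (p * r) q -> roots_separated e p q.
Proof.
have root_pr (x : C) :
    root (map_poly intr p) x -> root (map_poly intr (p * r)) x.
  by rewrite rmorphM rootM => ->.
case=> [sep|[pr0 q0 sep]]; [left|right; split=> //].
- by move=> x y /root_pr; apply: sep.
- by apply: contraNneq pr0 => p0; rewrite coef0M p0 mul0r.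
- by move=> x y /root_pr; apply: sep.
Qed.

(** The hypothesis on [e] says that [d < e ^+ M]; since [1 < e], raising the
    exponent to [(size p).-1 * (size q).-1], as in the lower bound on the
    resultant, only helps. *)
Lemma resultant_gt_of_separated (R : realType) (p q : {poly int}) (d M : nat)
    (e : R) :
    (1 < size p)%N -> q != 0 -> (0 < d)%N -> (0 < M <= (size q).-1)%N ->
    d%:R `^ M%:R^-1 < e -> roots_separated e%:C%C p q ->
  (d < `|resultant p q|)%N.
Proof.
move=> p_gt1 q_neq0 d_gt0 /andP[M_gt0 le_Mq] lt_e sep.
have p_neq0 : p != 0 by rewrite -size_poly_gt0 ltnW.
have e_ge0 : 0 <= e%:C%C by rewrite lecR (le_trans (powR_ge0 _ _) (ltW lt_e)).
rewrite -(ltr_nat R).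
have /(powR_inv_lt_expr _)/(_ lt_e) : (0 < M <= (size p).-1 * (size q).-1)%N.
  by rewrite M_gt0 (leq_trans le_Mq) // leq_pmull // -ltnS prednK // ltnW.
rewrite ler1n => /(_ d_gt0)/lt_le_trans; apply.
rewrite -lecR rmorphXn rmorph_nat natr_absz intr_norm.
case: sep => [sep|[p0 q0 sep]].
  exact: resultant_ge_root_separation.
exact: resultant_ge_inv_root_separation.
Qed.

(** One of the two symmetric halves of the conclusion. A factor of [f] has its roots
    among those of [f], so it remains separated from [g]. *)
Lemma product_of_at_most_separated (R : realType) (f g : {poly int}) (k : nat)
    (e : R) :
    (1 < size f)%N -> (1 < size g)%N -> resultant f g != 0 ->
    (dk R f g k)%:R `^ (minn (size g).-1 (size f).-1)%:R^-1 < e ->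
    roots_separated e%:C%C f g ->
  product_of_at_most_irreducibles k (int_to_rat_poly f).
Proof.
move=> f_gt1 g_gt1 res_neq0 lt_e sep.
have [l [irr_l def_f]] := int_poly_irreducible_factors f_gt1.
have nz (r : {poly int}) : (1 < size r)%N -> r != 0.
  by rewrite -size_poly_gt0 => /ltnW.
exists (map (fun p : {poly int} => int_to_rat_poly p) l); split.
- rewrite size_map.
  apply: (@size_factors_leq R f g) => //; [exact: nz|exact: nz|] => p l_p.
  have p_gt1 : (1 < size p)%N.
    by rewrite -size_rat_int_poly; have [] := irr_l p l_p.
  apply: resultant_gt_of_separated lt_e _ => //.
  + exact: nz.
  + exact: dk_gt0.
  + by rewrite geq_minl leq_min -!subn1 !subn_gt0 f_gt1 g_gt1.
  + apply: (@roots_separated_factor _ _ _ (\prod_(q <- rem p l) q)).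
    by have <- : f = p * \prod_(q <- rem p l) q by rewrite def_f (big_rem p).
- by move=> q /mapP[p /irr_l irr_p ->].
by rewrite big_map -rmorph_prod -def_f.
Qed.

Lemma resultant_neq0 (f g : {poly int}) :
  coprimep (int_to_rat_poly f) (int_to_rat_poly g) -> resultant f g != 0.
Proof.
rewrite -(intr_eq0 rat) -resultant_map_inj; last exact: intr_inj.
by rewrite resultant_eq0 coprimep_def => /eqP->.
Qed.

Lemma dkC (R : realType) (f g : {poly int}) (k : nat) :
  f != 0 -> g != 0 -> dk R f g k = dk R g f k.
Proof. by move=> f_neq0 g_neq0; rewrite /dk absz_resultantC. Qed.

Lemma min_dist_le (R : realType) (s t : seq R[i]) (x y : R[i]) :
  x \in s -> y \in t -> (min_dist s t)%:C%C <= `|x - y|.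
Proof.
move=> s_x t_y; have -> : `|x - y| = (Normc.normc (x - y))%:C%C.
  by rewrite normc_def; case: (x - y).
by rewrite lecR; apply: ge_bigmin_seq => //; apply: allpairs_f.
Qed.

Lemma lists_roots_mem (R : realType) (p : {poly int}) (s : seq R[i]) x :
  p != 0 -> lists_roots p s -> root (map_poly intr p) x -> x \in s.
Proof.
move=> p_neq0 ->; rewrite rootZ ?intr_eq0 ?lead_coef_eq0 //.
by rewrite root_prod_XsubC.
Qed.

Lemma lists_roots_coef0 (R : realType) (p : {poly int}) (s : seq R[i]) :
  p != 0 -> lists_roots p s -> \prod_(x <- s) x != 0 -> p`_0 != 0.
Proof.
move=> p_neq0 def_p s_neq0; rewrite -(intr_eq0 R[i]) -coef_map def_p coefZ.
by rewrite coef0_prod_XsubC !mulf_neq0 ?signr_eq0 // intr_eq0 lead_coef_eq0.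
Qed.

Theorem theorem2p3 (R : realType) (f g : {poly int}) (n m : nat)
    (hn : n = (size f).-1) (hm : m = (size g).-1)
    (hf : (1 < size f)%N) (hg : (1 < size g)%N)
    (hfg : coprimep (int_to_rat_poly f) (int_to_rat_poly g))
    (theta : n.-tuple R[i]) (xi : m.-tuple R[i])
    (htheta : lists_roots f theta) (hxi : lists_roots g xi)
    (hnz : (\prod_(x <- theta) x) * (\prod_(y <- xi) y) != 0)
    (k : nat) (hk : (0 < k)%N)
    (hsep :
       (dk R f g k)%:R `^ (minn m n)%:R^-1 < min_dist theta xi \/
       (dk R f g k)%:R `^ (minn m n)%:R^-1
         < min_dist (map GRing.inv theta) (map GRing.inv xi)) :
  product_of_at_most_irreducibles k (int_to_rat_poly f) /\
  product_of_at_most_irreducibles k (int_to_rat_poly g).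
Proof.
have [f_neq0 g_neq0] : f != 0 /\ g != 0 by split; rewrite -size_poly_gt0 ltnW.
have res_neq0 := resultant_neq0 hfg.
have [e lt_e sep] : exists2 e : R,
    (dk R f g k)%:R `^ (minn m n)%:R^-1 < e & roots_separated e%:C%C f g.
  case: hsep => lt_e; [exists (min_dist theta xi) => //|
    exists (min_dist (map GRing.inv theta) (map GRing.inv xi)) => //].
    left=> x y /(lists_roots_mem f_neq0 htheta) fx.
    by move=> /(lists_roots_mem g_neq0 hxi); apply: min_dist_le.
  move: hnz; rewrite mulf_eq0 negb_or => /andP[theta_neq0 xi_neq0].
  right; split; [exact: lists_roots_coef0 htheta _
                |exact: lists_roots_coef0 hxi _|].
  move=> x y /(lists_roots_mem f_neq0 htheta) fx.
  by move=> /(lists_roots_mem g_neq0 hxi) gy; apply: min_dist_le; apply: map_f.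
rewrite hn hm in lt_e; split.
  exact: product_of_at_most_separated lt_e sep.
rewrite dkC // minnC in lt_e.
apply: product_of_at_most_separated lt_e (roots_separatedC sep) => //.
by rewrite -absz_gt0 -absz_resultantC // absz_gt0.
Qed.
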